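(* Let $K$ be a field, $S=K[x_0,\ldots,x_n]$ with $x_0<x_1<\cdots<x_n$, let $J\subseteq S$ be a strongly stable monomial ideal and let $I$ be the homogeneous ideal generated by a $J$-marked set $G$. Then $\mathcal N(J)$ is a basis of $S/I$ as a $K$-vector space (i.e. $I$ belongs to the $J$-marked family) if and only if $\overline{S(f_\alpha,f_{\alpha'})}=0$ for all $f_\alpha,f_{\alpha'}\in G$, where $\overline{h}$ denotes the $V_m$-reduction of a homogeneous polynomial $h$ of degree $m$.
   Context: A term is a monomial $x^\alpha=x_0^{\alpha_0}\cdots x_n^{\alpha_n}$; for a term $x^\beta\neq 1$, $\min(x^\beta)$ is the smallest variable dividing it. A monomial ideal $J$ is strongly stable if for every term $x^\alpha\in J$ and all $0\le i<j\le n$ with $\alpha_i>0$, the term $x_j x^\alpha/x_i$ belongs to $J$. $B_J$ is the minimal set of monomial generators of $J$ and $\mathcal N(J)$ is the set of terms not in $J$. A $J$-marked set is a finite set $G$ of homogeneous polynomials $f_\alpha=x^\alpha-\sum c_{\alpha\gamma}x^\gamma$, $c_{\alpha\gamma}\in K$, each with marked head term $Ht(f_\alpha)=x^\alpha$, whose head terms are pairwise different and form exactly $B_J$, and such that every $x^\gamma$ appearing belongs to $\mathcal N(J)$. The $S$-polynomial is $S(f_\alpha,f_{\alpha'})=x^\beta f_\alpha-x^{\beta'}f_{\alpha'}$, where $x^{\beta+\alpha}=x^{\beta'+\alpha'}=\mathrm{lcm}(x^\alpha,x^{\alpha'})$. The sets $V_m$: to every term $x^\beta\in J$ associate a marked polynomial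 $g_\beta$ with $Ht(g_\beta)=x^\beta$, by induction on degree: if $x^\beta\in B_J$, $g_\beta$ is the element $f_\beta\in G$ with head term $x^\beta$; if $x^\beta\in J\setminus B_J$, put $x_i=\min(x^\beta)$, $x^\epsilon=x^\beta/x_i$ (which lies in $J$ by strong stability) and $g_\beta:=x_ig_\epsilon$. Then $V_m:=\{g_\beta : x^\beta\in J \text{ a term of degree } m\}$. $V_m$-reduction: one reduction step replaces a homogeneous $h$ of degree $m$ by $h-a\,g_\beta$, where $x^\beta\in J$ is a term occurring in $h$ with coefficient $a\ne 0$ and $g_\beta\in V_m$. The $V_m$-reduction $\overline{h}$ of $h$ is the homogeneous polynomial with support contained in $\mathcal N(J)$ obtained from $h$ by a finite sequence of such steps (the procedure terminates and the result is unique). *)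

(* Defs.v *)
From mathcomp Require Import all_boot all_order all_algebra.
From mathcomp Require Import mpoly.
From Stdlib Require Import Relations.

Set Implicit Arguments.
Unset Strict Implicit.
Unset Printing Implicit Defensive.

Import GRing.Theory.
Local Open Scope ring_scope.

Section MarkedSets.
Variables (K : fieldType) (n : nat).

(* Variables are ordered by index, so x_0 is the smallest one. *)
Local Notation S := {mpoly K[n.+1]}.
Local Notation term := 'X_{1..n.+1}.

Definition ideal_gen (A : S -> Prop) (p : S) : Prop :=
  exists s : seq (S * S),
    (forall u, u \in s -> A u.2) /\ p = \sum_(u <- s) u.1 * u.2.

Definition generated_by_terms (J : S -> Prop) (B : term -> Prop) : Prop :=
  forall p, J p <-> ideal_gen (fun q => exists2 b, B b & q = 'X_[b]) p.

Definition monomial_ideal (J : S -> Prop) : Prop :=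
  exists B, generated_by_terms J B.

Definition strongly_stable (J : S -> Prop) : Prop :=
  forall (a : term) (i j : 'I_n.+1),
    J 'X_[a] -> (i < j)%N -> (0 < a i)%N -> J 'X_[(a - U_(i) + U_(j))%MM].

(* [B] is B_J *)
Definition minimal_generators (J : S -> Prop) (B : term -> Prop) : Prop :=
  generated_by_terms J B /\
  forall B' : term -> Prop,
    (forall b, B' b -> B b) -> generated_by_terms J B' ->
    forall b, B b -> B' b.

(* the set N(J) *)
Definition nonterm (J : S -> Prop) (c : term) : Prop := ~ J 'X_[c].

Definition supported (P : term -> Prop) (p : S) : Prop :=
  forall c, c \in msupp p -> P c.

(* A marked polynomial is a pair (head term, polynomial). *)
Definition marked_set (J : S -> Prop) (B : term -> Prop)
    (G : seq (term * S)) : Prop :=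
  [/\ uniq (map fst G),
      forall a, a \in map fst G <-> B a &
      forall a f, (a, f) \in G ->
        (exists d, f \is d.-homog) /\ supported (nonterm J) (f - 'X_[a])].

Definition marked_ideal (G : seq (term * S)) : S -> Prop :=
  ideal_gen (fun f => exists a, (a, f) \in G).

Definition Spoly (u v : term * S) : S :=
  'X_[(mlcm u.1 v.1 - u.1)%MM] * u.2 - 'X_[(mlcm u.1 v.1 - v.1)%MM] * v.2.

Definition is_min_var (b : term) (i : 'I_n.+1) : Prop :=
  (0 < b i)%N /\ forall j : 'I_n.+1, (0 < b j)%N -> (i <= j)%N.

(* [gpoly J B G b g] : g is the polynomial g_b with head term x^b *)
Inductive gpoly (J : S -> Prop) (B : term -> Prop) (G : seq (term * S)) :
    term -> S -> Prop :=
| gpoly_gen b f : B b -> (b, f) \in G -> gpoly J B G b f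
| gpoly_mul b i g : J 'X_[b] -> ~ B b -> is_min_var b i ->
    gpoly J B G (b - U_(i))%MM g -> gpoly J B G b ('X_i * g).

(* V_m, as a set of marked polynomials (b, g_b) *)
Definition Vset (J : S -> Prop) (B : term -> Prop) (G : seq (term * S))
    (m : nat) (b : term) (g : S) : Prop :=
  [/\ J 'X_[b], mdeg b = m & gpoly J B G b g].

Definition Vstep (J : S -> Prop) (B : term -> Prop) (G : seq (term * S))
    (m : nat) (h h' : S) : Prop :=
  h \is m.-homog /\
  exists b g, [/\ Vset J B G m b g, b \in msupp h & h' = h - h@_b *: g].

(* [Vreduction J B G m h r] : r is the V_m-reduction of h *)
Definition Vreduction (J : S -> Prop) (B : term -> Prop) (G : seq (term * S))
    (m : nat) (h r : S) : Prop :=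
  [/\ h \is m.-homog, clos_refl_trans S (Vstep J B G m) h r,
      r \is m.-homog & supported (nonterm J) r].

(* The classes of the terms in [N] form a K-basis of S/I: equality of classes
   is congruence modulo I, so they span S/I and are linearly independent when
   the following holds.  In particular distinct terms have distinct classes. *)
Definition quotient_basis (I : S -> Prop) (N : term -> Prop) : Prop :=
  (forall p : S, exists (s : seq term) (c : term -> K),
      (forall b, b \in s -> N b) /\ I (p - \sum_(b <- s) c b *: 'X_[b])) /\
  (forall (s : seq term) (c : term -> K),
      uniq s -> (forall b, b \in s -> N b) ->
      I (\sum_(b <- s) c b *: 'X_[b]) -> forall b, b \in s -> c b = 0).

End MarkedSets.

(* Main.v *)
(** By strong stability every term of [J] factors uniquely as [x^e x^a] with
    [x^a] in [B_J] and [max(x^e) <= min(x^a)], and [g_(e+a) = x^e f_a].  Give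
    [x^e] the weight [sum_i e_i M^i] with [M] larger than the degrees in play:
    weights are additive and compare lexicographically, [x_n] first.  If
    [x^d x^c], with [x^c] outside [J], lies in [J] and factors as [x^e x^a],
    then [x^e] weighs less than [x^d].  So a reduction step by [g_(d+a)] only
    creates terms of [J] of smaller weight: reduction terminates, and no
    nontrivial combination of the [g]'s is supported outside [J].  If all
    S-polynomials reduce to 0, induction on the weight of [x^d] writes every
    [x^d f_a] as a combination of [g]'s, because [x^d f_a] differs from
    [g_(d+a)] by a multiple of an S-polynomial, whose reduction only uses
    multiples of lower weight.  Hence the [g]'s span the ideal [I]. *)
Require Import Defs.
From mathcomp Require Import all_boot all_order all_algebra.
From mathcomp Require Import mpoly zify.
From Stdlib Require Import Relations.

Set Implicit Arguments.
Unset Strict Implicit.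
Unset Printing Implicit Defensive.

Import GRing.Theory.
Local Open Scope ring_scope.

(** * Weights of cofactors and the star condition *)

Section StarDecomposition.
Variable n : nat.
Local Notation term := 'X_{1..n.+1}.
Implicit Types (e a c d : term) (M : nat).

(** The condition [max(x^e) <= min(x^a)]. *)
Definition star e a : Prop :=
  forall i j : 'I_n.+1, (0 < e i)%N -> (0 < a j)%N -> (i <= j)%N.

Definition weight M e : nat := (\sum_(i < n.+1) e i * M ^ i)%N.

Lemma weightD M d e : weight M (d + e)%MM = (weight M d + weight M e)%N.
Proof.
rewrite /weight -big_split /=; apply: eq_bigr => i _.
by rewrite mnmDE mulnDl.
Qed.

(** A gain of one at [k] is worth [M ^ k], more than everything [e'] has below [k], since its
    exponents sum to less than [M]. No bound on [e] is required. *)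
Lemma weight_lt M e e' (k : 'I_n.+1) :
  (mdeg e' < M)%N -> (e' k < e k)%N ->
  (forall j : 'I_n.+1, (k < j)%N -> (e' j <= e j)%N) ->
  (weight M e' < weight M e)%N.
Proof.
move=> ltM ltk lej.
have M_gt0 : (0 < M)%N by apply: leq_ltn_trans ltM.
(* The extra factor [M] turns the bound [M ^ (k - 1)] on positions below [k] into [M ^ k], which
   also makes sense for [k = 0]. *)
rewrite -(ltn_pmul2l M_gt0) /weight !big_distrr /=.
have splitk (f : 'I_n.+1 -> nat) : (\sum_i f i = \sum_(i < n.+1 | i < k) f i +
    (f k + \sum_(i < n.+1 | ~~ (i < k) && (i != k)) f i))%N.
  by rewrite (bigID (fun j : 'I_n.+1 => (j < k)%N)) /=
    [in X in (_ + X)%N](bigD1 k) ?ltnn.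
rewrite !splitk.
have H1 : (\sum_(i < n.+1 | ~~ (i < k) && (i != k)) M * (e' i * M ^ i) <=
           \sum_(i < n.+1 | ~~ (i < k) && (i != k)) M * (e i * M ^ i))%N.
  apply: leq_sum => i /andP[]; rewrite -leqNgt leq_eqVlt => /orP[/eqP/val_inj->|ki _].
    by rewrite eqxx.
  by rewrite leq_mul2l leq_mul2r lej // !orbT.
have H2 : (\sum_(i < n.+1 | (i < k)%N) M * (e' i * M ^ i) <= mdeg e' * M ^ k)%N.
  rewrite mdegE big_distrl /= [X in (_ <= X)%N](bigID (fun j : 'I_n.+1 => (j < k)%N)) /=.
  apply: leq_trans (leq_addr _ _); apply: leq_sum => i ik.
  by rewrite mulnCA leq_mul2l -expnS leq_pexp2l ?orbT.
have H3 : (mdeg e' * M ^ k < M * M ^ k)%N by rewrite ltn_pmul2r ?expn_gt0 ?M_gt0.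
have H4 : (M * (e' k * M ^ k) + M * M ^ k <= M * (e k * M ^ k))%N.
  by rewrite -mulnDr leq_mul2l -mulSnr leq_mul2r ltk !orbT.
move: H1 H2 H3 H4.
move: (\sum_(i | _) _)%N => x1.
move: (\sum_(i | _) _)%N => x2.
move: (\sum_(i | _) _)%N => x3.
move: (\sum_(i | _) _)%N => x4.
lia.
Qed.

(** Some [k] has [c k < a k], hence [e k < d k]. As [x_k] divides [x^a], the star condition forces
    [e] to vanish above [k]. *)
Lemma star_lt M e a d c :
  star e a -> (mdeg (e + a)%MM < M)%N -> (e + a = d + c)%MM ->
  ~~ (a <= c)%MM -> (weight M e < weight M d)%N.
Proof.
move=> st ltM eq /mnm_lepP nle.
have [k lt_ck] : exists k : 'I_n.+1, (c k < a k)%N.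
  apply/existsP; rewrite -[X in is_true X]negbK negb_exists.
  apply/negP => /forallP nlt; apply: nle => i.
  by rewrite leqNgt nlt.
have E i : (e i + a i = d i + c i)%N by rewrite -!mnmDE eq.
apply: (weight_lt (k := k)).
- by move: ltM; rewrite mdegD; lia.
- by have := E k; lia.
move=> j kj; have [-> //|ej] := posnP (e j).
by have := st _ _ ej (leq_ltn_trans (leq0n _) lt_ck); lia.
Qed.

End StarDecomposition.

Section MarkedSetTheory.
Variables (K : fieldType) (n : nat).
Local Notation S := {mpoly K[n.+1]}.
Local Notation term := 'X_{1..n.+1}.

(** * Generated ideals and supports of monomial multiples *)

Section IdealGen.
Variable A : S -> Prop.

Lemma ideal_gen0 : ideal_gen A 0.
Proof. by exists [::]; rewrite big_nil. Qed.

Lemma ideal_genD p q : ideal_gen A p -> ideal_gen A q -> ideal_gen A (p + q).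
Proof.
move=> [s [sA ->]] [t [tA ->]]; exists (s ++ t); rewrite big_cat; split=> // u.
by rewrite mem_cat => /orP[/sA|/tA].
Qed.

Lemma ideal_genM r p : ideal_gen A p -> ideal_gen A (r * p).
Proof.
move=> [s [sA ->]]; exists [seq (r * u.1, u.2) | u <- s]; split.
  by move=> _ /mapP[u us ->]; apply: sA us.
by rewrite big_map mulr_sumr; apply: eq_bigr => u _; rewrite mulrA.
Qed.

Lemma ideal_genZ (c : K) p : ideal_gen A p -> ideal_gen A (c *: p).
Proof. by rewrite -mul_mpolyC; apply: ideal_genM. Qed.

Lemma ideal_gen_mem p : A p -> ideal_gen A p.
Proof.
move=> Ap; exists [:: (1, p)]; rewrite big_seq1 mul1r; split=> // u.
by rewrite inE => /eqP->.
Qed.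

End IdealGen.

Lemma ideal_gen_sub (A : S -> Prop) (B : S -> Prop) p :
  (forall q, A q -> ideal_gen B q) -> ideal_gen A p -> ideal_gen B p.
Proof.
move=> AB [s [sA ->]]; rewrite big_seq.
by apply: (big_ind _ (ideal_gen0 B) (@ideal_genD B)) => u /sA/AB; apply: ideal_genM.
Qed.

Lemma mcoeffXM (a c : term) (p : S) : ('X_[a] * p)@_(a + c) = p@_c.
Proof. by rewrite mulrC mcoeffMX. Qed.

Lemma msuppXMP (a c : term) (p : S) :
  reflect (exists2 d, d \in msupp p & c = (a + d)%MM) (c \in msupp ('X_[a] * p)).
Proof.
apply: (iffP idP) => [|[d dp ->]]; last first.
  by rewrite mcoeff_msupp mcoeffXM -mcoeff_msupp.
rewrite mulrC (perm_mem (msuppMX p a)) => /mapP[d dp ->].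
by exists d.
Qed.

(** * Linear spans of indexed families *)

Section Span.
Variables (I : eqType) (v : I -> S).

Definition spanned (P : I -> Prop) (p : S) : Prop :=
  exists s : seq (K * I),
    (forall t, t \in s -> P t.2) /\ p = \sum_(t <- s) t.1 *: v t.2.

Variable P : I -> Prop.

Lemma spanned0 : spanned P 0.
Proof. by exists [::]; rewrite big_nil. Qed.

Lemma spannedD p q : spanned P p -> spanned P q -> spanned P (p + q).
Proof.
move=> [s [sP ->]] [t [tP ->]]; exists (s ++ t); rewrite big_cat; split=> // u.
by rewrite mem_cat => /orP[/sP|/tP].
Qed.

Lemma spannedZ c p : spanned P p -> spanned P (c *: p).
Proof.
move=> [s [sP ->]]; exists [seq (c * u.1, u.2) | u <- s]; split.
  by move=> _ /mapP[u us ->]; apply: sP us.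
by rewrite big_map scaler_sumr; apply: eq_bigr => u _; rewrite scalerA.
Qed.

Lemma spanned_mem i : P i -> spanned P (v i).
Proof.
move=> Pi; exists [:: (1, i)]; rewrite big_seq1 scale1r; split=> // u.
by rewrite inE => /eqP->.
Qed.

(** Coefficients of equal indices are added up, as a linear independence argument requires. *)
Lemma spanned_uniq p : spanned P p -> exists (s : seq I) (c : I -> K),
  [/\ uniq s, forall i, i \in s -> P i & p = \sum_(i <- s) c i *: v i].
Proof.
move=> [s [sP ->]].
exists (undup (map snd s)), (fun i => \sum_(t <- s | t.2 == i) t.1).
split; first exact: undup_uniq.
  by move=> i; rewrite mem_undup => /mapP[t /sP Pt ->].
under [RHS]eq_bigr do rewrite scaler_suml.
rewrite [RHS](exchange_big_dep xpredT) //= big_seq [RHS]big_seq.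
apply: eq_bigr => t ts; have tu : t.2 \in undup (map snd s).
  by rewrite mem_undup map_f.
rewrite -big_filter (_ : filter _ _ = [:: t.2]) ?big_seq1 //.
by rewrite (@eq_filter _ _ (pred1 t.2)) ?filter_pred1_uniq ?undup_uniq.
Qed.

End Span.

Lemma spanned_mul (I : eqType) (v : I -> S) (P Q : I -> Prop) (r p : S) :
  (forall i, P i -> spanned v Q (r * v i)) -> spanned v P p -> spanned v Q (r * p).
Proof.
move=> PQ [s [sP ->]]; rewrite mulr_sumr big_seq.
apply: (big_ind _ (spanned0 v Q) (@spannedD _ v Q)) => t /sP/PQ.
by rewrite -scalerAr; apply: spannedZ.
Qed.

(** * Heads and tails of marked polynomials and their multiples *)

Section MarkedSet.
Variables (J : S -> Prop) (hst : strongly_stable J).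
Variables (B : term -> Prop) (hB : minimal_generators J B).
Variables (G : seq (term * S)) (hG : marked_set J B G).

Lemma head_B u : u \in G -> B u.1.
Proof. by have [_ hH _] := hG; move=> uG; apply/hH/map_f. Qed.

(** In any expression of [x^c] through the generators, [x^c] occurs in some summand, hence is a
    multiple of that generator. *)
Lemma J_termP c : J 'X_[c] <-> exists2 u, u \in G & (u.1 <= c)%MM.
Proof.
have [genB _] := hB; have [_ hH _] := hG; split; last first.
  case=> u uG uc; apply/genB; rewrite -(submK uc) mpolyXD.
  by apply/ideal_genM/ideal_gen_mem; exists u.1 => //; apply: head_B.
move=> /genB[s [sB eq]].
have : ('X_[c] : S)@_c != 0 by rewrite mcoeffX eqxx oner_neq0.
rewrite eq raddf_sum /= => nz.
have [t ts tnz] : exists2 t, t \in s & (t.1 * t.2)@_c != 0.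
  apply/hasP; apply: contraNT nz => /hasPn nz.
  by rewrite big_seq big1 // => t /nz; rewrite negbK => /eqP.
have [b Bb tb] := sB _ ts; move: tnz.
rewrite tb -mcoeff_msupp mulrC => /msuppXMP[d _ ->].
by have /mapP[u uG ->] := (hH b).2 Bb; exists u => //; apply: lem_addr.
Qed.

Lemma head_inj u v : u \in G -> v \in G -> u.1 = v.1 -> u = v.
Proof.
have [uG _ _] := hG.
move=> hu hv eq; rewrite -(nth_index u hu) -(nth_index u hv); congr nth.
apply/eqP; rewrite -(nth_uniq u.1 _ _ uG) ?size_map ?index_mem //.
by rewrite !(nth_map u) ?index_mem // !nth_index // eq.
Qed.

(** A generator properly divisible by another could be dropped from [B], against minimality. *)
Lemma head_antichain u v : u \in G -> v \in G -> (u.1 <= v.1)%MM -> u = v.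
Proof.
move=> uG vG le; apply: head_inj => //; apply/eqP/negPn/negP => /eqP ne.
have [genB minB] := hB.
suff genB' : generated_by_terms J (fun b => B b /\ b <> v.1).
  by case: (minB _ (fun b => @proj1 _ _) genB' _ (head_B vG)).
move=> p; split=> [/genB|].
  apply: ideal_gen_sub => _ [b Bb ->]; have [->|/eqP bv] := eqVneq b v.1.
    rewrite -[X in 'X_[X]](submK le) mpolyXD; apply/ideal_genM/ideal_gen_mem.
    by exists u.1 => //; split=> //; apply: head_B.
  by apply: ideal_gen_mem; exists b.
by move=> h; apply/genB; move: h; apply: ideal_gen_sub => _ [b [Bb _] ->];
   apply: ideal_gen_mem; exists b.
Qed.

Lemma head_coeff u : u \in G -> u.2@_u.1 = 1.
Proof.
case: u => a f uG; have [_ _ /(_ _ _ uG)[_ hs]] := hG.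
have : a \notin msupp (f - 'X_[a]).
  by apply/negP => /hs nJa; apply: nJa; apply/J_termP; exists (a, f); rewrite ?lepm_refl.
by rewrite mcoeff_msupp negbK mcoeffB mcoeffX eqxx subr_eq0 => /eqP.
Qed.

Lemma tail_nonterm u c : u \in G -> c \in msupp u.2 -> c <> u.1 -> nonterm J c.
Proof.
case: u => a f uG /= cf ca; have [_ _ /(_ _ _ uG)[_ hs]] := hG.
apply: hs; rewrite mcoeff_msupp mcoeffB mcoeffX.
by case: (a =P c) => [/esym //|_]; rewrite subr0 -mcoeff_msupp.
Qed.

Lemma marked_homog u : u \in G -> u.2 \is (mdeg u.1).-homog.
Proof.
case: u => a f uG; have [_ _ /(_ _ _ uG)[[d hd] _]] := hG.
suff -> : mdeg a = d by [].
apply: (dhomog_mf hd); rewrite mcoeff_msupp.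
by have /= -> := head_coeff uG; apply: oner_neq0.
Qed.

(** The pair [(e, (a, f))] encodes [x^e f], whose head term is [x^(e+a)]. *)
Definition star_prod (x : term * (term * S)) : S := 'X_[x.1] * x.2.2.

Definition star_pair (x : term * (term * S)) : Prop :=
  x.2 \in G /\ star x.1 x.2.1.

Lemma star_prod_homog x : x.2 \in G -> star_prod x \is (mdeg (x.1 + x.2.1)%MM).-homog.
Proof.
by move=> uG; rewrite mdegD; apply: dhomogM; [rewrite dhomogX | apply: marked_homog].
Qed.

Lemma star_prod_head x : x.2 \in G -> (star_prod x)@_(x.1 + x.2.1) = 1.
Proof. by move=> uG; rewrite mcoeffXM head_coeff. Qed.

(** The term is [x^(x.1)] times a tail term of [x.2]. That tail term lies outside [J], so no
    generator divides it and [star_lt] applies. *)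
Lemma star_prod_tail M x y :
  x.2 \in G -> star_pair y -> (y.1 + y.2.1)%MM \in msupp (star_prod x) ->
  (y.1 + y.2.1 <> x.1 + x.2.1)%MM -> (mdeg (x.1 + x.2.1)%MM < M)%N ->
  (weight M y.1 < weight M x.1)%N.
Proof.
move=> xG [yG ysta] ys ne ltM.
have dy := dhomog_mf (star_prod_homog xG) ys.
have /msuppXMP[c cf eq] := ys.
apply: (star_lt ysta _ eq); first by rewrite dy.
apply/negP => yc; apply: (tail_nonterm xG cf).
  by move=> cx; apply: ne; rewrite eq cx.
by apply/J_termP; exists y.2.
Qed.

Lemma star_pair_lt M (u : term * S) d y :
  u \in G -> star_pair y -> (y.1 + y.2.1 = d + u.1)%MM -> y.2 <> u ->
  (mdeg (d + u.1)%MM < M)%N -> (weight M y.1 < weight M d)%N.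
Proof.
move=> uG [yG ysta] eq ne ltM; apply: (star_lt ysta _ eq); first by rewrite eq.
by apply/negP => /(head_antichain yG uG).
Qed.

(** With two different generators, [star_pair_lt] would make each cofactor lighter than the
    other. *)
Lemma star_pair_inj x y :
  star_pair x -> star_pair y -> (x.1 + x.2.1 = y.1 + y.2.1)%MM -> x = y.
Proof.
case: x y => [e u] [d v] sx sy /= eq.
have uv : u = v.
  apply/eqP/negPn/negP => /eqP ne; have M := ltnSn (mdeg (e + u.1)%MM).
  have := star_pair_lt (proj1 sx) sy (esym eq) (nesym ne) M.
  move: M; rewrite eq => M; have := star_pair_lt (proj1 sy) sx eq ne M.
  by rewrite /=; lia.
by rewrite uv in eq *; rewrite (addIm eq).
Qed.

(** * The polynomials [g_b] as star products *)

Lemma min_var_exists (b : term) : b <> 0%MM -> exists i, is_min_var b i.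
Proof.
move=> /eqP nz; have [i0 bi0] : exists i, (0 < b i)%N.
  move: nz; rewrite -mdeg_eq0 mdegE sum_nat_eq0 negb_forall => /existsP[i].
  by rewrite /= -lt0n; exists i.
case: (@arg_minnP _ i0 (fun i => 0 < b i)%N (@nat_of_ord _) bi0) => i bi mi.
by exists i; split.
Qed.

(** If a generator dividing [x^b] has the full power of [x_i], it misses a power of some larger
    [x_j]. Strong stability then supplies another divisor. *)
Lemma stable_div_min b i : J 'X_[b] -> ~ B b -> is_min_var b i -> J 'X_[(b - U_(i))%MM].
Proof.
move=> /J_termP[u uG ub] nB [bi mi].
have [le|lt] := ltnP (u.1 i) (b i).
  apply/J_termP; exists u => //; apply/mnm_lepP => j; rewrite mnmBE mnm1E.
  by case: eqVneq => [<-|_] /=;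
    [rewrite subn1 -ltnS prednK | rewrite subn0; apply: (mnm_lepP ub)].
have ui : u.1 i = b i by apply/eqP; rewrite eqn_leq lt andbT; apply: (mnm_lepP ub).
have [j ltj] : exists j, (u.1 j < b j)%N.
  apply/existsP; rewrite -[X in is_true X]negbK negb_exists.
  apply/negP => /forallP nlt; apply: nB; suff -> : b = u.1 by apply: head_B.
  apply/mnmP => j; apply/eqP; rewrite eqn_leq leqNgt nlt; apply: (mnm_lepP ub).
have ij : (i < j)%N.
  rewrite ltn_neqAle mi ?(leq_ltn_trans _ ltj) // andbT.
  by apply: contraTneq ltj => /val_inj <-; rewrite ui ltnn.
(* Trading one [x_i] for [x_j] stays in [J], and the result divides [x^b / x_i]. *)
have /J_termP[v vG le] : J 'X_[(u.1 - U_(i) + U_(j))%MM].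
  by apply: hst => //; [apply/J_termP; exists u; rewrite ?lepm_refl | rewrite ui].
apply/J_termP; exists v => //; apply: lepm_trans le _; apply/mnm_lepP => k.
have /mnm_lepP/(_ k) := ub; rewrite mnmDE !mnmBE !mnm1E.
case: (eqVneq j k) => [<-|_] /=; last by lia.
have /negbTE-> : i != j by apply: contraTneq ij => ->; rewrite ltnn.
by rewrite !subn0 addn1.
Qed.

(** The variable multiplied in is the smallest one of [x^b], so it does not exceed any variable of
    the generator and the star condition persists. *)
Lemma gpoly_star b g : gpoly J B G b g ->
  exists x, [/\ star_pair x, (x.1 + x.2.1 = b)%MM & g = star_prod x].
Proof.
elim=> {b g} [b f Bb bf|b i g Jb nB [bi mi] _ [[e u] [[/= uG st] eq ->]]].
  exists (0%MM, (b, f)); split=> //=; [split=> // i j | exact: add0m |].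
    by rewrite mnm0E.
  by rewrite /star_prod mpolyX0 mul1r.
have eqb : (e + u.1 + U_(i) = b)%MM by rewrite eq submK // lep1mP -lt0n.
exists ((e + U_(i))%MM, u); split => /=.
- split=> //= k j; rewrite mnmDE mnm1E => ek uj.
  have bj : (0 < b j)%N by rewrite -eqb !mnmDE; lia.
  by have := mi _ bj; move: ek; case: eqVneq => [<-//|_]; rewrite addn0 => /st/(_ uj).
- by rewrite -eqb -!addmA (addmC U_(i)%MM).
by rewrite /star_prod /= addmC mpolyXD mulrA.
Qed.

Lemma gpoly_exists b : J 'X_[b] -> exists g, gpoly J B G b g.
Proof.
have [_ hH _] := hG.
move: {2}(mdeg b).+1 (ltnSn (mdeg b)) => m; elim: m b => // m IH b ltm Jb.
have [/mapP[[a f] bG ->]|nb] := boolP (b \in map fst G).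
  by exists f; apply: gpoly_gen => //; apply: head_B bG.
have nB : ~ B b by move/hH; apply/negP.
have [|i mi] := @min_var_exists b.
  move=> b0; have /J_termP[u uG ub] := Jb; apply: nB.
  suff -> : b = u.1 by apply: head_B.
  by apply/mnmP => i; have /mnm_lepP/(_ i) := ub; rewrite b0 mnm0E; lia.
have [|g hg] := IH (b - U_(i))%MM _ (stable_div_min Jb nB mi).
  have [bi _] := mi; have /submK E : (U_(i) <= b)%MM by rewrite lep1mP -lt0n.
  by move: ltm; rewrite -{1}E mdegD mdeg1; lia.
by exists ('X_i * g); apply: gpoly_mul.
Qed.

Lemma star_pair_exists b : J 'X_[b] ->
  exists x, [/\ star_pair x, (x.1 + x.2.1 = b)%MM & gpoly J B G b (star_prod x)].
Proof.
by move=> /gpoly_exists[g bg]; have [x [sx eq gE]] := gpoly_star bg;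
   exists x; rewrite -gE.
Qed.

(** * Reduction steps, their weights and termination *)

Lemma msuppB_or (p q : S) c : c \in msupp (p - q) -> c \in msupp p \/ c \in msupp q.
Proof.
rewrite !mcoeff_msupp mcoeffB; case: (eqVneq (p@_c)) => [->|]; last by left.
by rewrite sub0r oppr_eq0; right.
Qed.

Lemma VstepP m h h' : Vstep J B G m h h' <->
  h \is m.-homog /\ exists x, [/\ star_pair x, mdeg (x.1 + x.2.1)%MM = m,
    (x.1 + x.2.1)%MM \in msupp h, gpoly J B G (x.1 + x.2.1)%MM (star_prod x) &
    h' = h - h@_(x.1 + x.2.1) *: star_prod x].
Proof.
split=> [[hm [b [g [[Jb db bg] bh ->]]]]|[hm [x [sx dx xh gx ->]]]].
  split=> //; have [x [sx eq gE]] := gpoly_star bg.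
  by exists x; rewrite eq -gE.
split=> //; exists (x.1 + x.2.1)%MM, (star_prod x); split=> //; split=> //.
by apply/J_termP; exists x.2; [case: sx | apply: lem_addl].
Qed.

Definition star_weight_bounded M k (h : S) : Prop :=
  forall x, star_pair x -> (x.1 + x.2.1)%MM \in msupp h -> (weight M x.1 < k)%N.

(** A step brings in only terms of [J] lighter than the one it removes, so the bound persists and
    every multiple subtracted obeys it. *)
Lemma Vsteps_spanned M m k h h' : (m < M)%N ->
  clos_refl_trans S (Vstep J B G m) h h' -> star_weight_bounded M k h ->
  star_weight_bounded M k h' /\
  spanned star_prod (fun x => [/\ star_pair x, mdeg (x.1 + x.2.1)%MM = m &
                                  (weight M x.1 < k)%N]) (h - h').
Proof.
move=> ltM; elim=> {h h'} [h h'|h|h1 h2 h3 _ IH12 _ IH23] bh; last first.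
- have [/IH23[b3 s23] s12] := IH12 bh; split=> //.
  by rewrite -(subrKA h2); apply: spannedD.
- by split=> //; rewrite subrr; apply: spanned0.
move/VstepP: bh => [hm [x [sx dx xh _ ->]]] bh.
split; last first.
  by rewrite opprB addrC subrK; apply/spannedZ/spanned_mem; split=> //; apply: bh.
move=> y sy /msuppB_or[|ys]; first exact: bh.
have [->|/eqP ne] := eqVneq y x; first exact: bh.
apply: leq_ltn_trans (bh _ sx xh); apply/ltnW/(star_prod_tail _ sy).
- by case: sx.
- exact: (msuppZ_le ys).
- by move=> /(star_pair_inj sy sx).
- by rewrite dx.
Qed.

(** [l] lists the terms of maximal weight [k] still to be reduced: termination
    is an induction on [k], then on [l]. *)
Definition star_weight_bounded_or M k (l : seq term) (h : S) : Prop :=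
  forall x, star_pair x -> (x.1 + x.2.1)%MM \in msupp h ->
    (weight M x.1 < k)%N \/ weight M x.1 = k /\ (x.1 + x.2.1)%MM \in l.

(** Reducing at [b] cancels [b], as heads have coefficient 1, and any new term of [J] has weight
    below [k]; so [b] leaves the list. *)
Lemma star_weight_bounded_step M m k b l h : (m < M)%N ->
  h \is m.-homog -> star_weight_bounded_or M k (b :: l) h ->
  exists h', [/\ clos_refl_trans S (Vstep J B G m) h h', h' \is m.-homog &
                 star_weight_bounded_or M k l h'].
Proof.
move=> ltM hm bh.
(* When [b] does not occur in [h] or is outside [J], it is dropped without a step. *)
have skip : (forall x, star_pair x -> (x.1 + x.2.1)%MM \in msupp h ->
    (x.1 + x.2.1)%MM <> b) -> exists h', [/\ clos_refl_trans S (Vstep J B G m) h h',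
      h' \is m.-homog & star_weight_bounded_or M k l h'].
  move=> nb; exists h; split=> //; first exact: rt_refl.
  move=> x sx xh; have [|[-> xl]] := bh x sx xh; [by left | right; split=> //].
  by move: xl; rewrite inE => /orP[/eqP/(nb _ sx xh)|].
have [xh|nbh] := boolP (b \in msupp h); last first.
  by apply: skip => x _ xh eq; rewrite -eq xh in nbh.
have [/hasP[u uG ub]|/hasPn nJ] := boolP (has (fun u => (u.1 <= b)%MM) G); last first.
  apply: skip => x [xG _] _ eq; have := nJ _ xG.
  by rewrite -eq lem_addl.
have [x [sx eq gx]] : exists x, [/\ star_pair x, (x.1 + x.2.1 = b)%MM &
    gpoly J B G b (star_prod x)].
  by apply: star_pair_exists; apply/J_termP; exists u.
have [xG _] := sx; have db : mdeg b = m := dhomog_mf hm xh.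
rewrite -eq in xh gx db.
have le_x : (weight M x.1 <= k)%N by case: (bh x sx xh) => [/ltnW|[->]].
exists (h - h@_(x.1 + x.2.1) *: star_prod x); split.
- by apply: rt_step; apply/VstepP; split=> //; exists x.
- by apply: rpredB => //; apply: rpredZ; rewrite -db; apply: star_prod_homog.
move=> y sy ys; have [yx|/eqP ne] := eqVneq y x.
  move: ys; rewrite yx mcoeff_msupp mcoeffB mcoeffZ star_prod_head //.
  by rewrite mulr1 subrr eqxx.
have neb : (y.1 + y.2.1 <> x.1 + x.2.1)%MM by move=> /(star_pair_inj sy sx).
case: (msuppB_or ys) => [yh|/msuppZ_le yx].
  have [|[-> yl]] := bh y sy yh; [by left | right; split=> //].
  by move: yl; rewrite inE -eq => /orP[/eqP|].
left; apply: leq_trans le_x; apply: (star_prod_tail xG sy yx neb).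
by rewrite db.
Qed.

Lemma Vreduction_exists m h : h \is m.-homog -> exists r, Vreduction J B G m h r.
Proof.
suff aux k : forall (l : seq term) h, h \is m.-homog ->
    star_weight_bounded_or m.+1 k l h -> exists r, Vreduction J B G m h r.
  (* By additivity the weight of a whole term bounds that of its cofactor; the successor makes the
     bound strict, so the list can start empty. *)
  move=> hm; apply: (aux (\max_(c <- msupp h) weight m.+1 c).+1 [::]) => //.
  move=> x sx xh; left; rewrite ltnS.
  apply: leq_trans (leq_bigmax_seq _ xh isT).
  by rewrite weightD leq_addr.
have cons_nil k' : (forall h, h \is m.-homog -> star_weight_bounded_or m.+1 k' [::] h ->
      exists r, Vreduction J B G m h r) ->
    forall (l : seq term) h, h \is m.-homog ->
    star_weight_bounded_or m.+1 k' l h -> exists r, Vreduction J B G m h r.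
  move=> nilP; elim=> [|b l IHl] {}h hm bh; first exact: nilP.
  have [h' [steps h'm /(IHl _ h'm)[r [_ steps' rm rN]]]] :=
    star_weight_bounded_step (ltnSn m) hm bh.
  by exists r; split=> //; apply: rt_trans steps'.
elim: k => [|k IHk]; apply: cons_nil => {}h hm bh; last first.
  (* All weights are now at most [k], and the whole support serves as the list for weight exactly
     [k]. *)
  apply: (IHk (msupp h)) => // x sx xh.
  have [|[_]] := bh x sx xh; last by rewrite in_nil.
  by rewrite ltnS leq_eqVlt => /orP[/eqP|]; [right | left].
(* At [k = 0] no term of [J] is left in [h]. *)
exists h; split=> //; first exact: rt_refl.
move=> c ch /star_pair_exists[x [sx eq _]]; rewrite -eq in ch.
by have [|[_]] := bh x sx ch; rewrite ?ltn0 ?in_nil.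
Qed.

(** * Reduction and S-polynomials inside the marked ideal *)

Lemma star_prod_marked_ideal x : star_pair x -> marked_ideal G (star_prod x).
Proof.
move=> [xG _]; apply/ideal_genM/ideal_gen_mem.
by exists x.2.1; rewrite -surjective_pairing.
Qed.

Lemma Vsteps_marked_ideal m h r :
  clos_refl_trans S (Vstep J B G m) h r -> marked_ideal G (h - r).
Proof.
elim=> {h r} [h r|h|h1 h2 h3 _ I12 _ I23].
- move/VstepP=> [_ [x [sx _ _ _ ->]]].
  by rewrite opprB addrC subrK; apply/ideal_genZ/star_prod_marked_ideal.
- by rewrite subrr; apply: ideal_gen0.
by rewrite -(subrKA h2); apply: ideal_genD.
Qed.

Lemma Spoly_homog u v : u \in G -> v \in G ->
  Spoly u v \is (mdeg (mlcm u.1 v.1)).-homog.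
Proof.
move=> uG vG.
have homL d w : w \in G -> (d + w.1 = mlcm u.1 v.1)%MM ->
    'X_[d] * w.2 \is (mdeg (mlcm u.1 v.1)).-homog.
  by move=> wG <-; apply: (@star_prod_homog (d, w)).
by apply: rpredB; apply: homL; rewrite ?submK ?lem_mlcml ?lem_mlcmr.
Qed.

Lemma Spoly_marked_ideal u v : u \in G -> v \in G -> marked_ideal G (Spoly u v).
Proof.
case: u v => [a f] [b g] uG vG; rewrite /Spoly -scaleN1r.
apply: ideal_genD; last apply: ideal_genZ; apply/ideal_genM/ideal_gen_mem.
  by exists a.
by exists b.
Qed.

(** * From vanishing S-polynomials to a spanning set of the ideal *)

Section Criterion.
Hypothesis Spoly_red : forall u v, u \in G -> v \in G ->
  Vreduction J B G (mdeg (mlcm u.1 v.1)) (Spoly u v) 0.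

(** The lcm cancels in the S-polynomial. Its other terms of [J] come from tails, so they weigh less
    than [d0] or than the lighter [e0], and [Vsteps_spanned] applies. *)
Lemma Spoly_spanned M u v d0 e0 : u \in G -> v \in G ->
  d0 = (mlcm u.1 v.1 - u.1)%MM -> e0 = (mlcm u.1 v.1 - v.1)%MM ->
  (mdeg (mlcm u.1 v.1) < M)%N -> (weight M e0 < weight M d0)%N ->
  spanned star_prod (fun x => [/\ star_pair x,
     mdeg (x.1 + x.2.1)%MM = mdeg (mlcm u.1 v.1) & (weight M x.1 < weight M d0)%N])
   (Spoly u v).
Proof.
move=> uG vG d0E e0E ltM lt.
have [_ steps _ _] := Spoly_red uG vG.
have du : (d0 + u.1 = mlcm u.1 v.1)%MM by rewrite d0E submK ?lem_mlcml.
have ev : (e0 + v.1 = mlcm u.1 v.1)%MM by rewrite e0E submK ?lem_mlcmr.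
rewrite -[Spoly u v]subr0; apply: (proj2 (Vsteps_spanned ltM steps _)).
move=> y sy ys; have ne : (y.1 + y.2.1 <> mlcm u.1 v.1)%MM.
  move=> eq; move: ys; rewrite eq mcoeff_msupp /Spoly -d0E -e0E mcoeffB.
  by rewrite -{1}du -ev !mcoeffXM !head_coeff // subrr eqxx.
have [yu|yv] := msuppB_or ys.
  by apply: (@star_prod_tail M (d0, u)) => //=; rewrite ?du // d0E.
apply: ltn_trans lt.
by apply: (@star_prod_tail M (e0, v)) => //=; rewrite ?ev // e0E.
Qed.

(** With [x^e f_v] the star product of the same head, [x^d f_u - x^e f_v] is a monomial multiple of
    an S-polynomial, handled by induction on the weight of [d]. *)
Lemma multiple_spanned d u : u \in G -> spanned star_prod star_pair ('X_[d] * u.2).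
Proof.
(* One [M] serves the whole induction, as recursive calls keep the total degree. *)
move=> uG; have [M ltM] : exists M, (mdeg (d + u.1)%MM < M)%N by exists (mdeg (d + u.1)%MM).+1.
move: {2}(weight M d).+1 (ltnSn (weight M d)) => k.
elim: k d u uG ltM => // k IH d u uG ltM ltk.
have [[e v] [/= sx eq _]] : exists x, [/\ star_pair x, (x.1 + x.2.1 = d + u.1)%MM
    & gpoly J B G (d + u.1)%MM (star_prod x)].
  by apply: star_pair_exists; apply/J_termP; exists u => //; apply: lem_addl.
have [vu|/eqP vu] := eqVneq v u.
  move: eq sx; rewrite vu => /addIm -> sx.
  exact: (spanned_mem star_prod sx).
have [vG _] := sx.
have led : (mlcm u.1 v.1 <= d + u.1)%MM by rewrite lem_mlcm lem_addl -eq lem_addl.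
pose w := (d + u.1 - mlcm u.1 v.1)%MM.
pose d0 := (mlcm u.1 v.1 - u.1)%MM; pose e0 := (mlcm u.1 v.1 - v.1)%MM.
have dE : d = (w + d0)%MM.
  by apply: (@addIm _ u.1); rewrite -addmA submK ?lem_mlcml // submK.
have eE : e = (w + e0)%MM.
  by apply: (@addIm _ v.1); rewrite -addmA submK ?lem_mlcmr // submK.
have -> : 'X_[d] * u.2 = 'X_[w] * Spoly u v + 'X_[e] * v.2.
  by rewrite /Spoly mulrBr !mulrA -!mpolyXD -/d0 -/e0 -dE -eE subrK.
apply: spannedD; last exact: (spanned_mem star_prod sx).
have lt0 : (weight M e0 < weight M d0)%N.
  have := star_pair_lt uG sx eq vu ltM.
  by rewrite /= eE dE !weightD ltn_add2l.
have degE : mdeg (d + u.1)%MM = (mdeg w + mdeg (mlcm u.1 v.1))%N.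
  by rewrite -mdegD submK.
have ltL : (mdeg (mlcm u.1 v.1) < M)%N by move: ltM; rewrite degE; lia.
apply: spanned_mul (Spoly_spanned uG vG erefl erefl ltL lt0).
(* Multiplying by [x^w] may destroy the star condition but preserves weight comparisons, so the
   induction hypothesis takes over. *)
move=> x [[xG _] dx ltx]; rewrite mulrA -mpolyXD; apply: IH => //.
  by rewrite -addmA mdegD dx -degE.
move: ltk; rewrite {1}dE !weightD ltnS; apply: leq_trans.
by rewrite ltn_add2l.
Qed.

Lemma marked_ideal_spanned p : marked_ideal G p -> spanned star_prod star_pair p.
Proof.
move=> [s [sG ->]]; rewrite big_seq.
apply: (big_ind _ (spanned0 _ _) (@spannedD _ _ _)) => t /sG[a aG].
elim/mpolyind: t.1 => [|c m q _ _ IH]; first by rewrite mul0r; apply: spanned0.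
rewrite mulrDl; apply: spannedD => //; rewrite -scalerAl; apply: spannedZ.
exact: (multiple_spanned m aG).
Qed.

End Criterion.

(** * Independence modulo the ideal, and spanning *)

(** Coefficients vanish from the heaviest cofactor downwards: the head of [x] has coefficient 0 in
    [p], and any other product containing it is heavier. *)
Lemma spanned_supported_eq0 p :
  spanned star_prod star_pair p -> supported (nonterm J) p -> p = 0.
Proof.
move=> /spanned_uniq[s [c [us sP pE]]] sp.
pose M := (\max_(x <- s) mdeg (x.1 + x.2.1)%MM).+1.
pose W := (\max_(x <- s) weight M x.1)%N.
suff c0 k x : x \in s -> (W - weight M x.1 < k)%N -> c x = 0.
  by rewrite pE big_seq big1 // => x xs; rewrite (c0 _.+1 x xs (ltnSn _)) scale0r.
elim: k x => // k IH x xs ltk.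
have p0 : p@_(x.1 + x.2.1) = 0.
  apply/eqP; rewrite -[_ == _]negbK -mcoeff_msupp; apply/negP => /sp nJ; apply: nJ.
  by apply/J_termP; exists x.2; [case: (sP _ xs) | apply: lem_addl].
move: p0; rewrite pE raddf_sum (bigD1_seq x) //= mcoeffZ star_prod_head ?mulr1; last first.
  by case: (sP _ xs).
rewrite big_seq_cond big1 ?addr0 // => y /andP[ys yx].
rewrite mcoeffZ; have [->|nz] := eqVneq ((star_prod y)@_(x.1 + x.2.1)) 0.
  by rewrite mulr0.
rewrite -mcoeff_msupp in nz.
have lt : (weight M x.1 < weight M y.1)%N.
  apply: (star_prod_tail _ (sP _ xs) nz); first by case: (sP _ ys).
    by move=> /(star_pair_inj (sP _ xs) (sP _ ys)) xy; rewrite xy eqxx in yx.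
  by rewrite ltnS; exact: (leq_bigmax_seq y ys isT).
have leW : (weight M y.1 <= W)%N by exact: (leq_bigmax_seq y ys isT).
rewrite IH ?mul0r //; apply: leq_trans (ltnSE ltk).
by apply: ltn_sub2l => //; apply: leq_trans leW.
Qed.

Lemma mcoeff_term_comb (s : seq term) (c : term -> K) b : uniq s ->
  (\sum_(a <- s) c a *: 'X_[a])@_b = if b \in s then c b else 0.
Proof.
move=> us; rewrite raddf_sum /=.
case: ifPn => [bs|nb].
  rewrite (bigD1_seq b) //= mcoeffZ mcoeffX eqxx mulr1 big1 ?addr0 // => a ne.
  by rewrite mcoeffZ mcoeffX (negbTE ne) mulr0.
rewrite big_seq big1 // => a sa; rewrite mcoeffZ mcoeffX.
by case: eqVneq nb => [<-|]; rewrite ?sa // mulr0.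
Qed.

(** Reduction acts on homogeneous polynomials, so [p] is treated term by term. *)
Lemma nonterm_spanning p : exists (s : seq term) (c : term -> K),
  (forall b, b \in s -> nonterm J b) /\
  marked_ideal G (p - \sum_(b <- s) c b *: 'X_[b]).
Proof.
suff [r [rN rI]] : exists r, supported (nonterm J) r /\ marked_ideal G (p - r).
  by exists (msupp r), (fun b => r@_b); rewrite -mpolyE.
elim/mpolyind: p => [|c m q _ _ [r [rN rI]]].
  exists 0; split; first by move=> c; rewrite msupp0.
  by rewrite subrr; apply: ideal_gen0.
have [|t [_ steps _ tN]] := @Vreduction_exists (mdeg m) 'X_[m]; first by rewrite dhomogX.
exists (c *: t + r); split.
  move=> b /(msuppD_le); rewrite mem_cat => /orP[/msuppZ_le|]; [exact: tN|exact: rN].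
rewrite opprD addrACA -scalerBr; apply: ideal_genD => //; apply: ideal_genZ.
exact: Vsteps_marked_ideal steps.
Qed.

End MarkedSet.
End MarkedSetTheory.

(** * Quotient bases versus vanishing S-polynomials *)

Theorem theorem3p12 (K : fieldType) (n : nat)
    (J : {mpoly K[n.+1]} -> Prop)
    (hJ : monomial_ideal J) (hst : strongly_stable J)
    (B : 'X_{1..n.+1} -> Prop) (hB : minimal_generators J B)
    (G : seq ('X_{1..n.+1} * {mpoly K[n.+1]})) (hG : marked_set J B G) :
  quotient_basis (marked_ideal G) (nonterm J) <->
  (forall u v, u \in G -> v \in G ->
     Vreduction J B G (mdeg (mlcm u.1 v.1)) (Spoly u v) 0%R).
Proof.
split=> [[_ free] u v uG vG | red].
  have [r red] := Vreduction_exists hst hB hG (Spoly_homog hB hG uG vG).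
  (* The reduction [r] lies in the ideal and is supported outside [J], so independence kills its
     coefficients. *)
  suff r0 : r = 0 by move: red; rewrite r0.
  have [_ steps _ rN] := red.
  have rI : marked_ideal G r.
    rewrite -[r](subKr (Spoly u v)) -scaleN1r.
    apply: ideal_genD; last apply: ideal_genZ.
      exact: (Spoly_marked_ideal uG vG).
    exact: (Vsteps_marked_ideal hB hG steps).
  move: rI; rewrite [X in marked_ideal G X]mpolyE => rI.
  have r0 := free _ _ (msupp_uniq r) rN rI.
  by rewrite [r]mpolyE big_seq big1 // => b /r0 ->; rewrite scale0r.
split=> [p|s c us sN sI b bs]; first exact: (nonterm_spanning hst hB hG).
(* [c b] is a coefficient of a combination that lies in the span of the star products and is
   supported outside [J], hence is zero. *)
have := mcoeff_term_comb c b us; rewrite bs => <-.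
rewrite (spanned_supported_eq0 hB hG (marked_ideal_spanned hst hB hG red sI)) ?mcoeff0 //.
move=> a; rewrite mcoeff_msupp mcoeff_term_comb //.
by case: ifP => [/sN|]; rewrite ?eqxx.
Qed.
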